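(* Let $(X,\mathcal S,U,f)$ be a splitting structure on a complete metric space $X$ satisfying condition (S5), and assume $A_\infty(B)=B$ for every $B\in\mathcal B(X)$. Let $\phi:X\to X$ be a bi-Lipschitz homeomorphism with constant $L>0$, i.e. $L^{-1}\mathbf d(x_1,x_2)\le\mathbf d(\phi(x_1),\phi(x_2))\le L\,\mathbf d(x_1,x_2)$ for all $x_1,x_2$. If $K\subseteq X$ is $\epsilon_0$-Cantor-winning on a ball $B$, then $\phi(K)$ is $\epsilon_0$-Cantor-winning on $I\phi(B)$. Moreover, if $K$ is $\epsilon_0$-Cantor-winning, then so is $\phi(K)$.
   Context: Let $(X,\mathbf d)$ be a metric space and $\mathcal B(X)$ the set of closed balls $B(x,r)$, each with centre $x$ and radius $r$. A splitting structure on $X$ is a quadruple $(X,\mathcal S,U,f)$ where: $U\subset\mathbb N$ is an infinite multiplicatively closed set such that $u,v\in U$, $u\mid v$ imply $v/u\in U$; $f:U\to\mathbb N$ is completely multiplicative; $\mathcal S$ assigns to each $B\in\mathcal B(X)$, $u\in U$ a collection $\mathcal S(B,u)$ of closed balls contained in $B$ of radius $\mathrm{rad}(B)/u$ with (S1) $\#\mathcal S(B,u)=f(u)$; (S2) distinct $b_1,b_2\in\mathcal S(B,u)$ have centres at distance $\ge2\mathrm{rad}(B)/u$; (S3) $\mathcal S(B,uv)=\bigcup_{b\in\mathcal S(B,u)}\mathcal S(b,v)$. $A_u(B):=\bigcup_{b\in\mathcal S(B,u)}b$, $A_\infty(B):=\bigcap_iA_{u_i}(B)$ for any $u_i\in U$,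 $u_i\mid u_{i+1}$, $u_i\to\infty$. Condition (S5): for each $K>1$ there is $C(K,X)$ such that any ball of radius $Kr$ intersects at most $C(K,X)$ pairwise disjoint open balls of radius $r$. For $B=B(x,r)$, $I\phi(B):=B(\phi(x),r/L)$. Generalised Cantor sets: given $B$, $R\in U$ and reals $\mathbf r=(r_{m,n})_{0\le m\le n}$, set $\mathcal B_0=\{B\}$; given $\mathcal B_n$, let $\mathcal I_{n+1}=\bigcup_{B_n\in\mathcal B_n}\mathcal S(B_n,R)$, $\mathcal I^{n+1}_{n+1}:=\mathcal I_{n+1}$, and for $k=0,\dots,n$ obtain $\mathcal I^{n-k}_{n+1}\subseteq\mathcal I^{n-k+1}_{n+1}$ by removing, for each $B_{n-k}\in\mathcal B_{n-k}$, at most $r_{n-k,n}$ balls from $\mathcal S(B_{n-k},R^{k+1})\cap\mathcal I^{n-k+1}_{n+1}$; put $\mathcal B_{n+1}:=\mathcal I^0_{n+1}$. Any resulting $\bigcap_n\bigcup_{b\in\mathcal B_n}b$ is a $(B,R,\mathbf r)$-Cantor set. Cantor-winning: $K$ is $\epsilon_0$-Cantor-winning on $B$ if for every $0<\epsilon<\epsilon_0$ there is $R_\epsilon\in U$ such that for every $R\in U$, $R\ge R_\epsilon$, $K$ contains some $(B,R,\mathbf r)$-Cantor set with $r_{m,n}=f(R)^{(n-m+1)(1-\epsilon)}$ for all $0\le m\le n$; $K$ is $\epsilon_0$-Cantor-winning if this holds on every $B\in\mathcal B(X)$. *)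

(* Defs.v *)
From HB Require Import structures.
From mathcomp Require Import all_boot all_order all_algebra.
From mathcomp Require Import all_classical all_reals all_analysis.

Set Implicit Arguments.
Unset Strict Implicit.
Unset Printing Implicit Defensive.

Import Order.TTheory GRing.Theory Num.Theory.

Local Open Scope classical_set_scope.
Local Open Scope card_scope.
Local Open Scope ring_scope.

(* A closed ball is a centre together with a positive radius; distinct (centre, *)
(* radius) data are distinct balls even if their point sets coincide.           *)
Record cball (R : realType) (X : metricType R) := CBall {
  center : X;
  radius : R;
  radius_gt0 : 0 < radius }.

Definition points (R : realType) (X : metricType R) (B : cball X) : set X :=
  [set y | mdist (center B) y <= radius B].

(* U and the values of f on U consist of positive integers; f u and             *)
(* split B u are meaningful only for u in U.                                    *)
Record splitting_structure (R : realType) (X : metricType R) := Splitting {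
  split_set : set nat;
  split_fun : nat -> nat;
  split : cball X -> nat -> set (cball X);
  split_set_gt0 : forall u, split_set u -> (0 < u)%N;
  split_set_infinite : infinite_set split_set;
  split_setM : forall u v, split_set u -> split_set v -> split_set (u * v)%N;
  split_set_div : forall u v,
    split_set u -> split_set v -> (u %| v)%N -> split_set (v %/ u)%N;
  split_fun_gt0 : forall u, split_set u -> (0 < split_fun u)%N;
  split_fun1 : split_fun 1 = 1%N;
  split_funM : forall u v, split_set u -> split_set v ->
    split_fun (u * v) = (split_fun u * split_fun v)%N;
  split_sub : forall B u, split_set u ->
    forall b, split B u b -> points b `<=` points B;
  split_radius : forall B u, split_set u ->
    forall b, split B u b -> radius b = radius B / u%:R;
  split_card : forall B u, split_set u -> split B u #= `I_(split_fun u);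
  split_sep : forall B u, split_set u ->
    forall b1 b2, split B u b1 -> split B u b2 -> b1 <> b2 ->
    2 * radius B / u%:R <= mdist (center b1) (center b2);
  splitM : forall B u v, split_set u -> split_set v ->
    split B (u * v)%N = \bigcup_(b in split B u) split b v }.

(* A_u(B) *)
Definition split_cover (R : realType) (X : metricType R)
    (S : splitting_structure X) (B : cball X) (u : nat) : set X :=
  \bigcup_(b in split S B u) points b.

Definition divisor_chain (R : realType) (X : metricType R)
    (S : splitting_structure X) (u : nat -> nat) : Prop :=
  [/\ forall i, split_set S (u i),
      forall i, (u i %| u i.+1)%N
    & u @ \oo --> \oo].

(* A_oo(B) = A, where A_oo(B) is computed along any divisor chain.              *)
Definition limit_set_is (R : realType) (X : metricType R)
    (S : splitting_structure X) (B : cball X) (A : set X) : Prop :=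
  forall u, divisor_chain S u -> \bigcap_i split_cover S B (u i) = A.

Definition bounded_packing (R : realType) (X : metricType R) : Prop :=
  forall K : R, 1 < K -> exists C : nat,
    forall (B : cball X) (r : R), 0 < r -> radius B = K * r ->
    forall A : set X,
      trivIset A (fun a => ball a r) ->
      (forall a, A a -> points B `&` ball a r !=set0) ->
      A #<= `I_C.

Definition complete_metric (R : realType) (X : metricType R) : Prop :=
  forall u : nat -> X, cauchy (u @ \oo) -> exists l : X, u @ \oo --> l.

Definition card_at_most (R : realType) (T : Type) (A : set T) (x : R) : Prop :=
  exists2 n : nat, A #= `I_n & n%:R <= x.

(* Bs n is the n-th collection of balls and I n m, for m <= n.+1, is the       *)
(* collection I^m_{n+1}; the exponent k + 1 with n - k = m is (n - m).+1.      *)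
(* D b is the set of balls removed on account of b.                            *)
Definition cantor_construction (R : realType) (X : metricType R)
    (S : splitting_structure X) (B : cball X) (M : nat) (r : nat -> nat -> R)
    (Bs : nat -> set (cball X)) (I : nat -> nat -> set (cball X)) : Prop :=
  [/\ Bs 0%N = [set B],
      forall n, I n n.+1 = \bigcup_(b in Bs n) split S b M,
      forall m n, (m <= n)%N -> exists D : cball X -> set (cball X),
        (forall b, Bs m b ->
           D b `<=` split S b (M ^ (n - m).+1)%N `&` I n m.+1 /\
           card_at_most (D b) (r m n)) /\
        I n m = I n m.+1 `\` \bigcup_(b in Bs m) D b
    & forall n, Bs n.+1 = I n 0%N].

Definition cantor_set (R : realType) (X : metricType R)
    (S : splitting_structure X) (B : cball X) (M : nat) (r : nat -> nat -> R)
    (C : set X) : Prop :=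
  exists Bs I, cantor_construction S B M r Bs I /\
    C = \bigcap_n \bigcup_(b in Bs n) points b.

Definition cantor_winning_on (R : realType) (X : metricType R)
    (S : splitting_structure X) (eps0 : R) (K : set X) (B : cball X) : Prop :=
  forall eps : R, 0 < eps -> eps < eps0 ->
  exists2 Meps : nat, split_set S Meps &
    forall M : nat, split_set S M -> (Meps <= M)%N ->
    exists2 C : set X,
      cantor_set S B M
        (fun m n => (split_fun S M)%:R `^ ((n - m).+1%:R * (1 - eps))) C
      & C `<=` K.

Definition cantor_winning (R : realType) (X : metricType R)
    (S : splitting_structure X) (eps0 : R) (K : set X) : Prop :=
  forall B : cball X, cantor_winning_on S eps0 K B.

Definition homeomorphism (X Y : topologicalType) (phi : X -> Y) : Prop :=
  exists psi : Y -> X,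
    [/\ cancel phi psi, cancel psi phi, continuous phi & continuous psi].

Definition bilipschitz (R : realType) (X : metricType R) (L : R)
    (phi : X -> X) : Prop :=
  forall x y, L^-1 * mdist x y <= mdist (phi x) (phi y) /\
              mdist (phi x) (phi y) <= L * mdist x y.

(* I phi (B) *)
Definition image_ball (R : realType) (X : metricType R) (phi : X -> X) (L : R)
    (L_gt0 : 0 < L) (B : cball X) : cball X :=
  CBall (phi (center B)) (divr_gt0 (radius_gt0 B) L_gt0).

(* Main.v *)
(* Given a Cantor set construction inside K, run a construction on I phi(B)   *)
(* that, at stage (m, n), discards every ball meeting the phi-image of a ball *)
(* discarded by the original one at stage (m, n). A point phi(x) that         *)
(* survives forces every level-n ball containing x to survive, since          *)
(* A_oo(B) = B provides such balls and removal of one of them would remove    *)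
(* the balls containing phi(x). By (S5), a level-m ball of one construction   *)
(* meets boundedly many of the other, so the removal counts grow by a bounded *)
(* factor. This factor is absorbed by passing from eps to (eps + eps0) / 2,   *)
(* because f(M) tends to infinity unless f = 1 on U. In the latter case one   *)
(* ball may be discarded at each stage, so the Cantor set may be empty.       *)

Require Import Defs.
From mathcomp Require Import all_boot all_order all_algebra.
From mathcomp Require Import all_classical all_reals all_analysis.
From mathcomp Require Import lra.

Import Order.TTheory GRing.Theory Num.Theory.
Import Defs.
Local Open Scope classical_set_scope.
Local Open Scope card_scope.
Local Open Scope ring_scope.

(** Up to factors of [L], [phi] carries level-n balls of one construction to sets of the size of
    level-n balls of the other. Centres within a level are separated, so (S5) bounds how many balls
    meet across [phi], uniformly in the starting ball, [M] and n ([count_preimages],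
    [count_images]). Removals can therefore be copied across [phi] at the cost of a factor [C1 * C2]
    in the quotas, and surviving points pull back into the original Cantor set because each level
    covers [B] ([cantor_set_image]). The factor is paid for by slack in eps: once [f(M)] is large,
    [f(M)^(eps' - eps)] exceeds [C1 * C2] ([split_fun_unbounded], [powR_absorb]). If [f = 1] on U,
    the quota 1 already allows everything to be removed ([cantor_winning_on_split_fun1]). The global
    statement follows from the local one because every ball is some [I phi (B)]
    ([image_ball_surj]). *)

(** * Cardinality bounds *)

Lemma card_le_injective (T U : Type) (A : set T) (B : set U) (f : T -> U) :
    (forall x, A x -> B (f x)) ->
    (forall x y, A x -> A y -> f x = f y -> x = y) ->
  A #<= B.
Proof.
move=> fAB f_inj.
have f_in : {in A &, injective f}.
  by move=> x y /set_mem Ax /set_mem Ay; exact: f_inj.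
rewrite -(card_le_eql (inj_card_eq f_in)); apply: subset_card_le.
by move=> _ [x Ax <-]; exact: fAB.
Qed.

Lemma card_leIP (T : Type) (A : set T) (n : nat) : A #<= `I_n ->
  exists f : T -> nat, (forall x, A x -> (f x < n)%N) /\
    (forall x y, A x -> A y -> f x = f y -> x = y).
Proof.
move=> /pcard_leP[f]; exists f; split=> [x Ax|x y Ax Ay].
  exact: (@funS _ _ _ _ f x Ax).
by apply: (@inj _ _ _ f); exact: mem_set.
Qed.

Lemma card_le_bigcup (I T : Type) (A : set I) (F : I -> set T) (a b : nat) :
    A #<= `I_a -> (forall i, A i -> F i #<= `I_b) ->
  \bigcup_(i in A) F i #<= `I_(a * b).
Proof.
move=> /card_leIP[h [h_lt h_inj]] Fb.
have /choice[g g_spec] : forall i, exists f : T -> nat, A i ->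
    (forall x, F i x -> (f x < b)%N) /\
    (forall x y, F i x -> F i y -> f x = f y -> x = y).
  move=> i; have [Ai|NAi] := pselect (A i); last by exists (fun=> 0%N).
  by have [f f_spec] := card_leIP _ _ _ (Fb i Ai); exists f.
have [[x0 [i0 _ _]]|no_elt] := pselect (\bigcup_(i in A) F i !=set0);
    last first.
  suff -> : \bigcup_(i in A) F i = set0 by rewrite card_ge0.
  by apply/seteqP; split=> // x Fx; apply: no_elt; exists x.
have /choice[c c_spec] : forall x, exists i,
    (\bigcup_(i in A) F i) x -> A i /\ F i x.
  move=> x; have [[i Ai Fix]|NFx] := pselect ((\bigcup_(i in A) F i) x).
    by exists i.
  by exists i0.
(* The pieces may overlap, so [c] selects one index for each x; the code has base-b digits: the rank
   of that index, then the rank of x in its piece. *)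
apply: (card_le_injective _ _ _ _ (fun x => (h (c x) * b + g (c x) x)%N)).
  move=> x Fx /=; have [Ac Fc] := c_spec x Fx.
  have [g_lt _] := g_spec _ Ac.
  apply: (@leq_trans ((h (c x)).+1 * b)); last by rewrite leq_mul2r h_lt ?orbT.
  by rewrite mulSn addnC ltn_add2r g_lt.
move=> x y Fx Fy; have [Acx Fcx] := c_spec x Fx; have [Acy Fcy] := c_spec y Fy.
have [g_ltx g_injx] := g_spec _ Acx; have [g_lty _] := g_spec _ Acy.
have b_gt0 : (0 < b)%N by apply: leq_ltn_trans (g_ltx _ Fcx).
move=> E; have cE : c x = c y.
  apply: h_inj => //; have := congr1 (divn^~ b) E.
  by rewrite /= !divnMDl// !divn_small ?addn0 ?g_ltx ?g_lty.
move: Fcy E; rewrite -cE => Fcy /addnI; exact: g_injx.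
Qed.

Lemma card_at_most_le (R : realType) (T : Type) (A : set T) (n : nat) (x : R) :
  A #<= `I_n -> n%:R <= x -> card_at_most A x.
Proof.
move=> An nx; have /finite_setP[k Ak] : finite_set A.
  by apply/finite_set_leP; exists n.
exists k => //; apply: le_trans nx; rewrite ler_nat -card_le_II.
by rewrite -(card_le_eql Ak).
Qed.

Lemma card_at_most_truncn (R : realType) (T : Type) (A : set T) (x : R) :
  card_at_most A x -> A #<= `I_(Num.truncn x).
Proof.
move=> [n An nx]; rewrite (card_le_eql An) card_le_II.
by rewrite -(natrK (R:=R) n) le_truncn.
Qed.

(** * Covering by levels and growth of f *)

Lemma center_in_points (R : realType) (X : metricType R) (b : cball X) :
  points b (center b).
Proof. by rewrite /points/= mdistxx ltW// radius_gt0. Qed.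

Lemma split_set_exp (R : realType) (X : metricType R)
    (S : splitting_structure X) (u k : nat) :
  split_set S u -> split_set S (u ^ k)%N.
Proof.
move=> Su; elim: k => [|k IHk]; last by rewrite expnS; exact: split_setM.
(* The number 1 is in U as u / u. *)
by have := split_set_div Su Su (dvdnn u); rewrite divnn (split_set_gt0 Su).
Qed.

Lemma split_fun_exp (R : realType) (X : metricType R)
    (S : splitting_structure X) (u k : nat) :
  split_set S u -> split_fun S (u ^ k) = (split_fun S u ^ k)%N.
Proof.
move=> Su; elim: k => [|k IHk]; first by rewrite !expn0 split_fun1.
by rewrite !expnS split_funM ?IHk//; exact: split_set_exp.
Qed.

(** The powers of M form a divisor chain, and the limit set along it, which is [B], lies in each
    term of the intersection. *)
Lemma points_sub_split_cover (R : realType) (X : metricType R)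
    (S : splitting_structure X) (B : cball X) (M n : nat) :
    limit_set_is S B (points B) -> split_set S M -> (1 < M)%N ->
  points B `<=` split_cover S B (M ^ n.+1).
Proof.
move=> Ainf SM M_gt1 x.
have chain : divisor_chain S (fun i => M ^ i.+1)%N.
  split=> [i|i|]; first exact: split_set_exp.
    by rewrite [in X in (_ %| X)%N]expnS dvdn_mull.
  apply/cvgnyPge => A; exists A => // i /= Ai.
  apply: leq_trans Ai _; apply: leq_trans (leqnSn i) (ltnW _).
  exact: ltn_expl.
by rewrite -{1}(Ainf _ chain) => /(_ n I).
Qed.

(* Covering B by split B M sends each centre of split B u into a ball too     *)
(* small to contain two of them.                                              *)
Lemma split_fun_lt_homo (R : realType) (X : metricType R)
    (S : splitting_structure X) (B : cball X) (u M : nat) :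
    limit_set_is S B (points B) -> split_set S u -> split_set S M ->
    (u < M)%N -> (split_fun S u <= split_fun S M)%N.
Proof.
move=> Ainf Su SM uM; have u_gt0 := split_set_gt0 Su.
rewrite -card_le_II -(card_le_eql (split_card B Su)).
rewrite -(card_le_eqr (split_card B SM)).
have /choice[g g_spec] : forall b, exists c, split S B u b ->
    split S B M c /\ points c (center b).
  move=> b; have [Sb|NSb] := pselect (split S B u b); last by exists b.
  have := @points_sub_split_cover _ _ S B M 0 Ainf SM (leq_ltn_trans u_gt0 uM).
  move=> /(_ _ (split_sub Su Sb (center_in_points _ _ b))).
  by rewrite expn1 => -[c Sc cb]; exists c.
apply: (card_le_injective _ _ _ _ g) => [b /g_spec[]//|b1 b2 Sb1 Sb2 gE].
apply: contrapT => b12; have := split_sep Su Sb1 Sb2 b12.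
have [Sg1 g1] := g_spec _ Sb1; have [_ ] := g_spec _ Sb2; rewrite -gE => g2.
have := metric_triangle (center b1) (center (g b1)) (center b2).
rewrite (metric_sym (center b1) (center (g b1))).
move: g1 g2; rewrite /points /=.
rewrite (split_radius SM Sg1) => g1 g2 tri; apply/negP; rewrite -ltNge.
have : radius B / M%:R < radius B / u%:R.
  rewrite ltr_pM2l ?radius_gt0// ltf_pV2 ?ltr_nat//.
  - by rewrite posrE ltr0n (leq_ltn_trans _ uM).
  - by rewrite posrE ltr0n.
by rewrite -mulrA; lra.
Qed.

(** Powers of u already make f large, since f(u^k) = f(u)^k > k; monotonicity of f extends this to
    all larger M in U. *)
Lemma split_fun_unbounded (R : realType) (X : metricType R)
    (S : splitting_structure X) (B : cball X) (u : nat) (x : R) :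
    limit_set_is S B (points B) -> split_set S u -> (1 < split_fun S u)%N ->
  exists2 N : nat, split_set S N &
    forall M, split_set S M -> (N < M)%N -> x <= (split_fun S M)%:R.
Proof.
move=> Ainf Su fu_gt1; set k := (Num.truncn x).+1.
exists (u ^ k)%N; first exact: split_set_exp.
move=> M SM uM; apply: (@le_trans _ _ k%:R); first exact/ltW/truncnS_gt.
rewrite ler_nat; apply: leq_trans (split_fun_lt_homo _ _ _ _ _ _ Ainf _ SM uM).
  by rewrite split_fun_exp// ltnW// ltn_expl.
exact: split_set_exp.
Qed.

Lemma cantor_winning_on_split_fun1 (R : realType) (X : metricType R)
    (S : splitting_structure X) (eps0 : R) (K : set X) (B : cball X) :
    (forall u, split_set S u -> split_fun S u = 1%N) ->
  cantor_winning_on S eps0 K B.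
Proof.
move=> f1 eps _ _; have /infinite_setN0[u Su] := @split_set_infinite _ _ S.
exists u => // M SM _; exists set0 => //; rewrite (f1 M SM).
(* Here [split S B M] is a single ball and every quota is 1, so stage (0, 0) removes that ball and
   all later collections are empty. *)
exists (fun n => if n is 0 then [set B] else set0).
exists (fun n m => if (n == 0)%N && (m == 1)%N then split S B M else set0).
split; last first.
  by apply/seteqP; split=> // x /(_ 1%N I)[].
split=> //.
- by case=> [|n]/=; rewrite ?bigcup_set1// bigcup_set0.
- move=> [|m] [|n] // _.
  + exists (fun=> split S B M); split=> [b ->|].
      rewrite /= expn1 setIid; split=> //; exists 1%N; last by rewrite powR1.
      by rewrite -(f1 M SM); exact: split_card.
    by rewrite /= bigcup_set1 setDv.
  + exists (fun=> set0); split=> [b _|].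
      by split=> //; exists 0%N; rewrite ?II0//= powR1.
    by rewrite /= set0D.
  + exists (fun=> set0); split=> [b //|].
    by rewrite /= set0D.
- by move=> n; rewrite andbF.
Qed.

(** * Levels of the iterated splitting and packing *)

(* The case n = 0 is separate because the axioms do not give split B 1 = {B}. *)
Definition split_level {R : realType} {X : metricType R}
    (S : splitting_structure X) (B : cball X) (M n : nat) : set (cball X) :=
  if n is 0 then [set B] else split S B (M ^ n)%N.

Lemma split_level_radius (R : realType) (X : metricType R)
    (S : splitting_structure X) (B b : cball X) (M n : nat) :
  split_set S M -> split_level S B M n b -> radius b = radius B / (M ^ n)%:R.
Proof.
case: n => [|n] SM; first by move=> ->; rewrite expn0 divr1.
exact/split_radius/split_set_exp.
Qed.

Lemma split_level_sep (R : realType) (X : metricType R)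
    (S : splitting_structure X) (B b1 b2 : cball X) (M n : nat) :
    split_set S M -> split_level S B M n b1 -> split_level S B M n b2 ->
    b1 <> b2 ->
  2 * (radius B / (M ^ n)%:R) <= mdist (center b1) (center b2).
Proof.
case: n => [|n] SM; first by move=> -> ->.
by rewrite mulrA; exact/split_sep/split_set_exp.
Qed.

Lemma split_levelS (R : realType) (X : metricType R)
    (S : splitting_structure X) (B : cball X) (M n : nat) : split_set S M ->
  split_level S B M n.+1 = \bigcup_(b in split_level S B M n) split S b M.
Proof.
move=> SM; case: n => [|n]; first by rewrite /= bigcup_set1 expn1.
by rewrite /= [in LHS]expnSr splitM//; exact: split_set_exp.
Qed.

(** Separation by 2r makes the open r-balls around the centres disjoint, and each meets the ball of
    radius K r around p at its own centre. Counting centres suffices, as separated balls have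
    distinct centres. *)
Lemma card_le_packing (R : realType) (X : metricType R) (K : R) (C : nat) :
    (forall (B : cball X) (r : R), 0 < r -> radius B = K * r ->
      forall A : set X, trivIset A (fun a => ball a r) ->
      (forall a, A a -> points B `&` ball a r !=set0) -> A #<= `I_C) ->
    0 < K ->
  forall (T : set (cball X)) (p : X) (r : R), 0 < r ->
    (forall b1 b2, T b1 -> T b2 -> b1 <> b2 ->
      2 * r <= mdist (center b1) (center b2)) ->
    (forall b, T b -> mdist p (center b) <= K * r) ->
  T #<= `I_C.
Proof.
move=> packing K_gt0 T p r r_gt0 T_sep T_near.
have c_inj : {in T &, injective (@center R X)}.
  move=> b1 b2 /set_mem T1 /set_mem T2 cE; apply: contrapT => b12.
  by have := T_sep _ _ T1 T2 b12; rewrite cE mdistxx; lra.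
rewrite -(card_le_eql (inj_card_eq c_inj)).
apply: (packing (CBall p (mulr_gt0 K_gt0 r_gt0)) r) => //.
  move=> _ _ [b1 T1 <-] [b2 T2 <-] [z []]; rewrite !ballEmdist/= => z1 z2.
  apply: contrapT => c12; have := T_sep _ _ T1 T2.
  have := metric_triangle (center b1) z (center b2).
  have b12 : b1 <> b2 by move=> b12; apply: c12; rewrite b12.
  by rewrite (metric_sym z) => tri /(_ b12); lra.
move=> _ [b Tb <-]; exists (center b); split; first exact: T_near.
by rewrite ballEmdist/= mdistxx.
Qed.

Lemma stage_sub_level (R : realType) (X : metricType R)
    (S : splitting_structure X) (B : cball X) (M : nat)
    (Bs : nat -> set (cball X)) :
    split_set S M -> Bs 0%N = [set B] ->
    (forall n, Bs n.+1 `<=` \bigcup_(b in Bs n) split S b M) ->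
  forall n, Bs n `<=` split_level S B M n.
Proof.
move=> SM Bs0 BsS; elim=> [|n IHn]; first by rewrite Bs0.
rewrite (split_levelS _ _ _ _ _ _ SM); apply: subset_trans (BsS n) _.
exact: bigcup_subset.
Qed.

Lemma cantor_construction_substage (R : realType) (X : metricType R)
    (S : splitting_structure X) (B : cball X) (M : nat) (r : nat -> nat -> R)
    (Bs : nat -> set (cball X)) (I : nat -> nat -> set (cball X)) (n m : nat) :
    cantor_construction S B M r Bs I -> (m <= n.+1)%N ->
  I n m `<=` \bigcup_(b in Bs n) split S b M.
Proof.
move=> [_ ItopE Idown _] mn; rewrite -ItopE -(subKn mn).
elim: (n.+1 - m)%N (leq_subr m n.+1) => [_|k IHk kn]; first by rewrite subn0.
have [|D [_ ->]] := Idown (n.+1 - k.+1)%N n; first by rewrite subSS leq_subr.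
rewrite -subSn// subSS.
by apply: subset_trans (@subDsetl _ _ _) (IHk (ltnW kn)).
Qed.

(** * Transporting a construction through phi *)

Definition meets {R : realType} {X : metricType R} (phi : X -> X)
    (d b : cball X) : Prop :=
  exists2 z, points d z & points b (phi z).

(** The difference of consecutive substages records what stage (m, n) really removed, without
    reference to the witness [D]. *)
Definition meets_removed {R : realType} {X : metricType R} (phi : X -> X)
    (I : nat -> nat -> set (cball X)) (n m : nat) (b : cball X) : Prop :=
  exists2 d, (I n m.+1 `\` I n m) d & meets phi d b.

Fixpoint image_stage {R : realType} {X : metricType R}
    (S : splitting_structure X) (phi : X -> X) (B : cball X) (M : nat)
    (I : nat -> nat -> set (cball X)) (n : nat) : set (cball X) :=
  if n is k.+1 then
    [set b | (\bigcup_(b0 in image_stage S phi B M I k) split S b0 M) b /\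
             forall j, (j <= k)%N -> ~ meets_removed phi I k j b]
  else [set B].

(** Substages of the transported construction are filters on one collection: for m = n + 1 the range
    of j is empty and nothing is removed, while m = 0 gives the next stage. *)
Definition image_substage {R : realType} {X : metricType R}
    (S : splitting_structure X) (phi : X -> X) (B : cball X) (M : nat)
    (I : nat -> nat -> set (cball X)) (n m : nat) : set (cball X) :=
  [set b | (\bigcup_(b0 in image_stage S phi B M I n) split S b0 M) b /\
           forall j, (m <= j <= n)%N -> ~ meets_removed phi I n j b].

Lemma image_stage_level (R : realType) (X : metricType R)
    (S : splitting_structure X) (phi : X -> X) (B : cball X) (M : nat)
    (I : nat -> nat -> set (cball X)) (n : nat) : split_set S M ->
  image_stage S phi B M I n `<=` split_level S B M n.
Proof. by move=> SM; apply: stage_sub_level => // k b []. Qed.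

(** Finds the level-j ball to which a removal is charged. A parent in a positive stage is itself in
    substage 0 one level down, and (S3) merges the successive splittings into one. *)
Lemma image_substage_ancestor (R : realType) (X : metricType R)
    (S : splitting_structure X) (phi : X -> X) (B : cball X) (M : nat)
    (I : nat -> nat -> set (cball X)) (n m j : nat) (b : cball X) :
    split_set S M -> (j <= n)%N -> image_substage S phi B M I n m b ->
  exists2 b0, image_stage S phi B M I j b0 & split S b0 (M ^ (n - j).+1)%N b.
Proof.
move=> SM; elim: n m b => [|n IHn] m b.
  by rewrite leqn0 => /eqP-> [[b0 b0B b0b] _]; exists b0; rewrite ?subnn ?expn1.
rewrite leq_eqVlt => /predU1P[->|jn] [[b1 b1B b1b] _].
  by exists b1; rewrite ?subnn ?expn1.
have [|b0 b0B b0b1] := IHn 0%N b1 jn.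
  by case: b1B => ? rm; split=> // i /andP[_]; exact: rm.
exists b0 => //; rewrite (@subSn j n jn) expnSr splitM//; first by exists b1.
exact: split_set_exp.
Qed.

Lemma cantor_set_image (R : realType) (X : metricType R)
    (S : splitting_structure X) (phi psi : X -> X) (L : R) (L_gt0 : 0 < L)
    (B : cball X) (M C1 C2 : nat) (r r' : nat -> nat -> R)
    (Bs : nat -> set (cball X)) (I : nat -> nat -> set (cball X)) :
    limit_set_is S B (points B) -> cancel psi phi -> bilipschitz L phi ->
    split_set S M -> (1 < M)%N ->
    (forall m (b' : cball X),
      split_level S (image_ball phi L_gt0 B) M m b' ->
      split_level S B M m `&` [set b | meets phi b b'] #<= `I_C1) ->
    (forall n (d : cball X), split_level S B M n d ->
      split_level S (image_ball phi L_gt0 B) M n `&` [set b | meets phi d b]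
        #<= `I_C2) ->
    (forall m n, (m <= n)%N ->
      (C1 * (Num.truncn (r m n) * C2))%:R <= r' m n) ->
    cantor_construction S B M r Bs I ->
  exists2 C : set X, cantor_set S (image_ball phi L_gt0 B) M r' C
    & C `<=` phi @` (\bigcap_n \bigcup_(b in Bs n) points b).
Proof.
move=> Ainf psiK lip SM M_gt1 count1 count2 rr' BsI.
set B' := image_ball phi L_gt0 B.
have lvl' n := image_stage_level _ _ S phi B' M I n SM.
have [Bs0 ItopE Idown BsS] := BsI.
have lvl n : Bs n `<=` split_level S B M n.
  apply: stage_sub_level n => // n; rewrite BsS.
  exact: cantor_construction_substage BsI _.
set Bs' := image_stage S phi B' M I; set I' := image_substage S phi B' M I.
exists (\bigcap_n \bigcup_(b in Bs' n) points b).
  exists Bs', I'; split=> //; split=> //.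
  - move=> n; apply/seteqP; split=> [b []//|b Bb]; split=> // j.
    by move=> /andP[/leq_trans/[apply]]; rewrite ltnn.
  - move=> m n mn.
    exists (fun b' => split S b' (M ^ (n - m).+1)%N `&` I' n m.+1
                      `&` [set b | meets_removed phi I n m b]).
    split=> [b' Bb'|]; last first.
      apply/seteqP; split=> b.
        move=> [Sb keep]; split.
          by split=> // j /andP[mj jn]; apply: keep; rewrite jn (ltnW mj).
        by move=> [b' _ [_ /=]]; apply: keep; rewrite leqnn.
      move=> [[Sb keep] ND]; split=> // j /andP[].
      rewrite leq_eqVlt => /predU1P[<- _|mj jn]; last first.
        by apply: keep; rewrite mj.
      move=> rm; apply: ND.
      have [|b0 b0B b0b] :=
        image_substage_ancestor _ _ S phi B' M I n m.+1 m b SM mn.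
        by split.
      by exists b0.
    split; first exact: subIsetl.
    have [D [D_spec ImE]] := Idown m n mn.
    apply: card_at_most_le (rr' m n mn).
    (* Three nested counts: at most [C1] original balls b meet b', each has a removed set [D b]
       within quota, and each removed d meets at most [C2] balls of level n + 1. *)
    pose A := Bs m `&` [set b | meets phi b b'].
    pose E d := split_level S B' M n.+1 `&` [set b | meets phi d b].
    have D_level b d : Bs m b -> D b d -> split_level S B M n.+1 d.
      move=> Bb Db; rewrite (split_levelS _ _ _ _ _ _ SM).
      have [/(_ _ Db)[_ Id] _] := D_spec _ Bb.
      have [b1 /lvl b1B b1d] :=
        cantor_construction_substage _ _ _ _ _ _ _ _ n m.+1 BsI mn _ Id.
      by exists b1.
    apply: (@card_le_trans _ _ _ (\bigcup_(b in A) \bigcup_(d in D b) E d)).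
      apply: subset_card_le => b [[b'b I'b] [d [Id NId] [z dz bz]]].
      have [b0 b0B Db0d] : (\bigcup_(b in Bs m) D b) d.
        by apply: contrapT => ND; apply: NId; rewrite ImE.
      (* The same z shows that b0 meets b', because d lies in b0 and b in b'. *)
      exists b0.
        split=> //; exists z.
          have [/(_ _ Db0d)[b0d _] _] := D_spec _ b0B.
          exact: split_sub (split_set_exp _ _ _ _ _ SM) _ b0d _ dz.
        exact: split_sub (split_set_exp _ _ _ _ _ SM) _ b'b _ bz.
      exists d => //; split; last by exists z.
      rewrite (split_levelS _ _ _ _ _ _ SM).
      by case: I'b => -[b1 /lvl' b1B b1b] _; exists b1.
    apply: card_le_bigcup.
      apply: card_le_trans (count1 m b' (lvl' _ _ Bb')).
      by apply: subset_card_le => b [/lvl].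
    move=> b [Bb _]; apply: card_le_bigcup.
      by apply: card_at_most_truncn; case: (D_spec _ Bb).
    move=> d Db; apply: count2; exact: D_level Db.
move=> y yC; exists (psi y); rewrite ?psiK//.
(* The radius of [I phi (B)] is divided by [L] exactly so that its preimage stays inside [B]. *)
have By : points B (psi y).
  have [_ -> /=] := yC 0%N Logic.I; rewrite /points/= => yB.
  have [] := lip (center B) (psi y); rewrite psiK => + _.
  rewrite ler_pdivrMl// => h; apply: le_trans h _.
  by rewrite mulrC -ler_pdivlMr.
(* The claim concerns every level-n ball containing [psi y], so the induction applies to whichever
   parent the splitting supplies. *)
have all_in n b : split_level S B M n b -> points b (psi y) -> Bs n b.
  elim: n b => [|n IHn] b; first by rewrite Bs0.
  rewrite (split_levelS _ _ _ _ _ _ SM) => -[b0 b0B b0b] by_.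
  have : I n n.+1 b.
    rewrite ItopE; exists b0 => //; apply: IHn => //.
    exact: (split_sub SM b0b).
  have down m k : (m + k = n.+1)%N -> I n n.+1 b -> I n m b.
    elim: k m => [|k IHk] m; first by rewrite addn0 => ->.
    rewrite -addSnnS => mk Ib; have {}Ib := IHk _ mk Ib.
    (* If b were removed at stage (m, n), the surviving ball b' of level n + 1 through y = phi (psi
       y) would meet it, and so would have been removed too. *)
    apply: contrapT => NIb.
    have [b' [_ keep] b'y] := yC n.+1 Logic.I.
    apply: (keep m); first by rewrite -ltnS -mk leq_addr.
    by exists b => //; exists (psi y); rewrite ?psiK.
  by rewrite BsS; exact: down (add0n _).
move=> [_|n _]; first by exists B; rewrite ?Bs0.
have [b Sb by_] := points_sub_split_cover _ _ S B M n Ainf SM M_gt1 _ By.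
by exists b => //; apply: all_in.
Qed.

(** * Balls meeting across phi *)

Lemma split_level_radius_gt0 (R : realType) (X : metricType R)
    (S : splitting_structure X) (B : cball X) (M n : nat) :
  split_set S M -> 0 < radius B / (M ^ n)%:R.
Proof.
move=> SM; rewrite divr_gt0 ?radius_gt0// ltr0n expn_gt0.
by rewrite (split_set_gt0 SM).
Qed.

(** With rho the level-n radius under [B], both the centre of b and [psi (center b')] are within rho
    of the common point z: b' has radius rho / L, and the preimage loses a factor [L]. Hence the
    packing constant 2. *)
Lemma count_preimages (R : realType) (X : metricType R)
    (S : splitting_structure X) (phi psi : X -> X) (L : R) (L_gt0 : 0 < L) :
    bounded_packing X -> cancel psi phi -> bilipschitz L phi ->
  exists C : nat, forall (B : cball X) (M n : nat) (b' : cball X),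
    split_set S M -> split_level S (image_ball phi L_gt0 B) M n b' ->
    split_level S B M n `&` [set b | meets phi b b'] #<= `I_C.
Proof.
move=> S5 psiK lip; have [|C packing] := S5 2; first by lra.
exists C => B M n b' SM Sb'.
have r_gt0 := split_level_radius_gt0 _ _ S B M n SM.
apply: (card_le_packing _ _ 2 C packing _ _ (psi (center b')) _ r_gt0).
- by [].
- by move=> b1 b2 [Sb1 _] [Sb2 _]; exact: split_level_sep SM Sb1 Sb2.
move=> b [Sb [z bz b'z]].
have := metric_triangle (psi (center b')) z (center b).
have [+ _] := lip (psi (center b')) z; rewrite psiK.
rewrite ler_pdivrMl// => lip_z tri.
move: bz b'z; rewrite /points/= (split_level_radius _ _ _ _ _ _ _ SM Sb).
rewrite (split_level_radius _ _ _ _ _ _ _ SM Sb')/= => bz.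
rewrite [radius B / L / _]mulrAC ler_pdivlMr// mulrC => b'z.
apply: le_trans tri _; rewrite (metric_sym z) mulr_natl mulr2n.
by apply: lerD => //; exact: le_trans b'z.
Qed.

(** The centre of b is within L rho + rho / L of [phi (center d)], which is L^2 + 1 times the radius
    rho / L of b. *)
Lemma count_images (R : realType) (X : metricType R)
    (S : splitting_structure X) (phi : X -> X) (L : R) (L_gt0 : 0 < L) :
    bounded_packing X -> bilipschitz L phi ->
  exists C : nat, forall (B : cball X) (M n : nat) (d : cball X),
    split_set S M -> split_level S B M n d ->
    split_level S (image_ball phi L_gt0 B) M n `&` [set b | meets phi d b]
      #<= `I_C.
Proof.
move=> S5 lip; have L2_gt0 : 0 < L ^+ 2 by rewrite exprn_gt0.
have [|C packing] := S5 (L ^+ 2 + 1); first by lra.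
exists C => B M n d SM Sd; set B' := image_ball phi L_gt0 B.
have r_gt0 := split_level_radius_gt0 _ _ S B' M n SM.
apply: (card_le_packing _ _ _ C packing _ _ (phi (center d)) _ r_gt0).
- by lra.
- by move=> b1 b2 [Sb1 _] [Sb2 _]; exact: split_level_sep SM Sb1 Sb2.
move=> b [Sb [z dz bz]].
have := metric_triangle (phi (center d)) (phi z) (center b).
have [_] := lip (center d) z.
move: dz bz; rewrite /points/= (split_level_radius _ _ _ _ _ _ _ SM Sd).
rewrite (split_level_radius _ _ _ _ _ _ _ SM Sb)/= (metric_sym (center b)).
have -> : (L ^+ 2 + 1) * (radius B / L / (M ^ n)%:R) =
    L * (radius B / (M ^ n)%:R) + radius B / L / (M ^ n)%:R.
  rewrite mulrDl mul1r; congr (_ + _).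
  by rewrite expr2 -mulrA mulrAC [L * (_ / L)]mulrC divfK ?gt_eqF.
move=> dz bz Lz tri; apply: le_trans tri _; apply: lerD => //.
by apply: le_trans Lz _; rewrite ler_pM2l.
Qed.

(** * Absorbing the constant and conclusion *)

(** The hypothesis says c <= f^(eps' - eps), and the exponents differ by k + 1 >= 1 times eps' -
    eps, so one threshold on f serves all k. *)
Lemma powR_absorb (R : realType) (c f eps eps' : R) (k : nat) :
    0 <= c -> 1 <= f -> eps < eps' -> c `^ (eps' - eps)^-1 <= f ->
  c * f `^ (k.+1%:R * (1 - eps')) <= f `^ (k.+1%:R * (1 - eps)).
Proof.
move=> c_ge0 f_ge1 lt_eps cf; have f_gt0 : 0 < f by exact: lt_le_trans f_ge1.
have d_gt0 : 0 < eps' - eps by rewrite subr_gt0.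
have c_le : c <= f `^ (eps' - eps).
  rewrite -[leLHS]powRr1// -(mulVf (lt0r_neq0 d_gt0)) powRrM.
  by apply: ge0_ler_powR => //; rewrite ?ltW// nnegrE ?powR_ge0// ltW.
have -> : k.+1%:R * (1 - eps) =
    k.+1%:R * (eps' - eps) + k.+1%:R * (1 - eps') :> R by lra.
rewrite powRD; last by rewrite (gt_eqF f_gt0) implybT.
apply: ler_wpM2r; first exact: powR_ge0.
apply: le_trans c_le _; apply: ler_powR => //.
by rewrite ler_peMl ?ler1n// ltW.
Qed.

Lemma cantor_winning_on_image (R : realType) (X : metricType R)
    (S : splitting_structure X) (phi psi : X -> X) (L : R) (L_gt0 : 0 < L)
    (eps0 : R) (K : set X) (B : cball X) :
    bounded_packing X -> limit_set_is S B (points B) ->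
    cancel psi phi -> bilipschitz L phi ->
    cantor_winning_on S eps0 K B ->
  cantor_winning_on S eps0 (phi @` K) (image_ball phi L_gt0 B).
Proof.
move=> S5 Ainf psiK lip winK.
have [[u Su fu]|f1] :=
  pselect (exists2 u, split_set S u & (1 < split_fun S u)%N); last first.
  apply: cantor_winning_on_split_fun1 => u Su; apply/eqP.
  rewrite eqn_leq (split_fun_gt0 Su) andbT leqNgt; apply/negP => fu.
  by apply: f1; exists u.
have [C1 count1] := count_preimages _ _ S phi psi L L_gt0 S5 psiK lip.
have [C2 count2] := count_images _ _ S phi L L_gt0 S5 lip.
move=> eps eps_gt0 eps_lt; pose eps' := (eps + eps0) / 2.
have [||N1 SN1 winN1] := winK eps'; [by rewrite /eps'; lra..|].
pose c : R := (C1 * C2)%:R.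
have [N2 SN2 fN2] := split_fun_unbounded _ _ _ _ _ (c `^ (eps' - eps)^-1)
  Ainf Su fu.
have u_gt1 : (1 < u)%N.
  rewrite ltn_neqAle (split_set_gt0 Su) andbT; apply/eqP => u1.
  by move: fu; rewrite -u1 split_fun1.
(* A product stays in U, is at least [N1], and strictly exceeds [N2] because u > 1. *)
exists (N1 * (N2 * u))%N.
  by apply: split_setM => //; apply: split_setM.
have N1_gt0 := split_set_gt0 SN1; have N2_gt0 := split_set_gt0 SN2.
move=> M SM NM.
have N1M : (N1 <= M)%N.
  by apply: leq_trans NM; rewrite leq_pmulr// muln_gt0 N2_gt0 ltnW.
have N2M : (N2 < M)%N.
  apply: leq_trans NM; apply: (@leq_trans (N2 * u)); last by rewrite leq_pmull.
  by rewrite ltn_Pmulr.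
have [C [Bs [I [BsI ->]]] CK] := winN1 M SM N1M.
have [||||C' winC' C'K] := cantor_set_image _ _ S phi psi L L_gt0 B M C1 C2 _
  (fun m n => (split_fun S M)%:R `^ ((n - m).+1%:R * (1 - eps))) Bs I Ainf psiK
  lip SM _ _ _ _ BsI.
- exact: leq_ltn_trans N2M.
- by move=> m b'; exact: count1.
- by move=> n d; exact: count2.
- move=> m n mn /=; rewrite mulnCA mulnC natrM.
  apply: (@le_trans _ _
    (c * (split_fun S M)%:R `^ ((n - m).+1%:R * (1 - eps')))).
    by apply: ler_wpM2l => //; rewrite truncn_le powR_ge0.
  apply: powR_absorb => //; last exact: fN2.
    by rewrite ler1n (split_fun_gt0 SM).
  by rewrite /eps'; lra.
exists C' => //; apply: subset_trans C'K _; exact: image_subset.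
Qed.

(** Pull the centre back by psi and multiply the radius by [L]. *)
Lemma image_ball_surj (R : realType) (X : metricType R) (phi psi : X -> X)
    (L : R) (L_gt0 : 0 < L) (B : cball X) : cancel psi phi ->
  exists B0, image_ball phi L_gt0 B0 = B.
Proof.
case: B => x r r_gt0 psiK; exists (CBall (psi x) (mulr_gt0 r_gt0 L_gt0)).
rewrite /image_ball/=; move: (divr_gt0 _ _); rewrite psiK mulfK ?gt_eqF// => h.
by congr CBall; exact: Prop_irrelevance.
Qed.

Theorem theorem10 (R : realType) (X : metricType R)
    (S : splitting_structure X)
    (X_complete : complete_metric X)
    (S5 : bounded_packing X)
    (Ainf : forall B : cball X, limit_set_is S B (points B))
    (phi : X -> X) (phi_homeo : homeomorphism phi)
    (L : R) (L_gt0 : 0 < L) (phi_lip : bilipschitz L phi)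
    (eps0 : R) (K : set X) :
  (forall B : cball X, cantor_winning_on S eps0 K B ->
     cantor_winning_on S eps0 (phi @` K) (image_ball phi L_gt0 B)) /\
  (cantor_winning S eps0 K -> cantor_winning S eps0 (phi @` K)).
Proof.
have [psi [_ psiK _ _]] := phi_homeo.
have part1 B : cantor_winning_on S eps0 K B ->
    cantor_winning_on S eps0 (phi @` K) (image_ball phi L_gt0 B).
  exact: cantor_winning_on_image.
split=> // winK B'; have [B <-] := image_ball_surj _ _ phi psi _ L_gt0 B' psiK.
exact: part1.
Qed.
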